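(* There exist dynamic flow networks with only one capacity change in which every minimum dynamic cut and every maximum dynamic flow has exponential complexity: for every $\ell\in\mathbb{N}^+$ there is a dynamic flow network of size polynomial in $\ell$ with only one capacity change such that every minimum dynamic cut and every maximum dynamic flow has complexity at least $2^\ell$. This holds even with acyclic underlying graphs and with discrete time (all transit times, capacity change times and the time horizon being integer multiples of a common time unit, so that time may be discretized into units of that length).
   Context: A dynamic flow network with time-dependent capacities: directed graph $G=(V,E)$, source $s$, target $t$, time horizon $T$, constant transit times $\tau_e\ge0$ and capacity functions $u_e\colon[0,T]\to\mathbb{R}_{\ge0}$ with finitely many discontinuities; ''only one capacity change'' means all capacities are constant except one edge whose capacity function has a single jump. A dynamic flow is a family of measurable $f_e\colon[0,T-\tau_e]\to\mathbb{R}$ with $f_e\le u_e$ and strong flow conservation (excess $\int_0^\Theta(\sum_{e=(u,v)}f_e(\zeta-\tau_e)-\sum_{e=(v,u)}f_e(\zeta))d\zeta=0$ for all $v\ne s,t$, $\Theta\in[0,T]$); its value is the excess of $t$ at $T$. A dynamic cut is a family $S_v\colon[0,T]\to\{0,1\}$ with $S_s\equiv1$, $S_t\equiv0$ on $[0,T]$, $S_v(\Theta)=1$ for $\Theta>T$, of capacity $\int_0^T\sum_{e=(v,w):S_v(\Theta)=1,S_w(\Theta+\tau_e)=0}u_e(\Theta)d\Theta$. A vertex changes partition at $\Theta$ if $S_v(\Theta-\delta)\ne S_v(\Theta+\delta)$ for all small $\delta>0$; the complexity of a cut is the total number of partition changes over all vertices. Analogously, the complexity of a flow is the total number of changes of the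 functions $f_e$ over all edges.
   Formalization: A change at a time means not almost-everywhere constant near it (the pointwise definition is defeated by altering an optimal cut on a null set); flows are taken nonnegative, cuts measurable, and size counts vertices plus edges. *)

(* Defs.v *)
From HB Require Import structures.
From mathcomp Require Import all_boot all_order all_algebra.
From mathcomp Require Import all_classical all_reals all_analysis.
Unset Printing Implicit Defensive.
Import Order.TTheory GRing.Theory Num.Theory.
Import numFieldNormedType.Exports.
Local Open Scope classical_set_scope.
Local Open Scope ring_scope.

Record network (R : realType) := Network {
  nv : nat;
  ne : nat;
  tl : 'I_ne -> 'I_nv;
  hd : 'I_ne -> 'I_nv;
  src : 'I_nv;
  snk : 'I_nv;
  horizon : R;
  transit : 'I_ne -> R;
  cap : 'I_ne -> R -> R }.
Arguments Network {R}.
Arguments nv {R}. Arguments ne {R}. Arguments tl {R}. Arguments hd {R}.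
Arguments src {R}. Arguments snk {R}. Arguments horizon {R}.
Arguments transit {R}. Arguments cap {R}.

Unset Implicit Arguments.

Section DynFlow.
Context {R : realType}.
Variable N : network R.

Local Notation T := (horizon N).
Local Notation tau := (transit N).
Local Notation u := (cap N).

Definition valid_network : Prop :=
  src N != snk N /\ 0 <= T /\ (forall e, 0 <= tau e) /\
  (forall e x, 0 <= x <= T -> 0 <= u e x).

Definition one_capacity_change_at (e0 : 'I_(ne N)) (theta0 a b : R) : Prop :=
  0 < theta0 < T /\ a != b /\
  (forall x, u e0 x = if x < theta0 then a else b) /\
  (forall e, e != e0 -> exists c, forall x, u e x = c).

Definition acyclic_network : Prop :=
  forall (e0 : 'I_(ne N)) (p : seq 'I_(ne N)),
    path (fun e1 e2 => hd N e1 == tl N e2) e0 p -> hd N (last e0 p) != tl N e0.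

Definition integer_multiple (delta x : R) : Prop := exists k : nat, x = k%:R * delta.

(* a dynamic flow: f e is (extended by 0 outside) a measurable function on
   [0, T - tau_e] with 0 <= f_e <= u_e, satisfying strong flow conservation *)
Definition excess (f : 'I_(ne N) -> R -> R) (v : 'I_(nv N)) (Theta : R) : R :=
  \int[lebesgue_measure]_(z in `[0, Theta])
     (\sum_(e | hd N e == v) f e (z - tau e) - \sum_(e | tl N e == v) f e z).

Definition is_dyn_flow (f : 'I_(ne N) -> R -> R) : Prop :=
  (forall e, measurable_fun [set: R] (f e)) /\
  (forall e x, ~ (0 <= x <= T - tau e) -> f e x = 0) /\
  (forall e x, 0 <= x <= T - tau e -> 0 <= f e x <= u e x) /\
  (forall v, v != src N -> v != snk N ->
     forall Theta, 0 <= Theta <= T -> excess f v Theta = 0).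

Definition flow_value (f : 'I_(ne N) -> R -> R) : R := excess f (snk N) T.

Definition is_max_dyn_flow (f : 'I_(ne N) -> R -> R) : Prop :=
  is_dyn_flow f /\ forall g, is_dyn_flow g -> flow_value g <= flow_value f.

Definition is_dyn_cut (S : 'I_(nv N) -> R -> bool) : Prop :=
  (forall v, measurable [set x | S v x]) /\
  (forall x, 0 <= x <= T -> S (src N) x) /\
  (forall x, 0 <= x <= T -> ~~ S (snk N) x) /\
  (forall v x, T < x -> S v x).

Definition cut_capacity (S : 'I_(nv N) -> R -> bool) : \bar R :=
  (\int[lebesgue_measure]_(x in `[0%R, T]%classic)
     (\sum_(e | S (tl N e) x && ~~ S (hd N e) (x + tau e)) u e x)%:E)%E.

Definition is_min_dyn_cut (S : 'I_(nv N) -> R -> bool) : Prop :=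
  is_dyn_cut S /\ forall S', is_dyn_cut S' -> (cut_capacity S <= cut_capacity S')%E.

Definition locally_ae_const {X : Type} (g : R -> X) (x : R) : Prop :=
  exists2 d : R, 0 < d & exists c : X,
    lebesgue_measure [set y | x - d < y < x + d /\ g y <> c] = 0%E.

Definition cut_change (S : 'I_(nv N) -> R -> bool) (v : 'I_(nv N)) (x : R) : Prop :=
  0 < x /\ ~ locally_ae_const (S v) x.

Definition flow_change (f : 'I_(ne N) -> R -> R) (e : 'I_(ne N)) (x : R) : Prop :=
  0 < x < T - tau e /\ ~ locally_ae_const (f e) x.

Definition cut_complexity_ge (S : 'I_(nv N) -> R -> bool) (k : nat) : Prop :=
  exists s : seq ('I_(nv N) * R),
    uniq s /\ (k <= size s)%N /\ forall p, p \in s -> cut_change S p.1 p.2.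

Definition flow_complexity_ge (f : 'I_(ne N) -> R -> R) (k : nat) : Prop :=
  exists s : seq ('I_(ne N) * R),
    uniq s /\ (k <= size s)%N /\ forall p, p \in s -> flow_change f p.1 p.2.

End DynFlow.

(* Main.v *)
Require Import Defs.
From HB Require Import structures.
From mathcomp Require Import all_boot all_order all_algebra.
From mathcomp Require Import all_classical all_reals all_analysis.
From mathcomp Require Import measurable_realfun.
From mathcomp Require Import zify ring lra.
Import Order.TTheory GRing.Theory Num.Theory.
Import numFieldNormedType.Exports.
Local Open Scope classical_set_scope.
Local Open Scope ring_scope.

(* The network is a chain s -> v_0 => v_1 => ... => v_l -> t.  The edge s -> v_0
   has a large capacity during [0, 1) and capacity 0 afterwards; v_i and v_(i+1)
   are joined by two parallel edges of large capacity, with transit times 0 and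
   2^(i+1); the edge v_l -> t has capacity 1.  Flow leaving s during [0, 1) can
   reach v_l exactly during the 2^l intervals [2j, 2j + 1) with j < 2^l, and only
   v_l -> t is a bottleneck.  A maximum flow therefore has value 2^l and
   saturates v_l -> t on these intervals while it vanishes in between.
   For a cut, fix x in [0, 1) and consider the times x + k together: either a
   large-capacity edge is cut, or v_l is on the source side at all x + 2j, which
   already costs 2^l, and each x + 2j + 1 at which v_l is on the source side
   costs 1 more.  So in a minimum cut v_l alternates as well. *)

(** * Integrals of bounded measurable functions over bounded intervals, and a criterion for a
    change *)

Section BoundedMeasurable.
Context {R : realType}.
Implicit Types (f g : R -> R) (a b c x : R).
Local Notation mu := (@lebesgue_measure R).

(** Global boundedness and measurability settle every integrability condition on a bounded interval,
    and the class is closed under the operations used below. *)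
Definition bounded_mfun g : Prop :=
  measurable_fun [set: R] g /\ exists M, forall x, `|g x| <= M.

Lemma bounded_mfunD f g : bounded_mfun f -> bounded_mfun g ->
  bounded_mfun (fun x => f x + g x).
Proof.
move=> [mf [M fM]] [mg [M' gM']]; split; first exact: measurable_funD.
exists (M + M') => x; apply: le_trans (ler_normD _ _) _; exact: lerD.
Qed.

Lemma bounded_mfunB f g : bounded_mfun f -> bounded_mfun g ->
  bounded_mfun (fun x => f x - g x).
Proof.
move=> [mf [M fM]] [mg [M' gM']]; split; first exact: measurable_funB.
exists (M + M') => x; apply: le_trans (ler_normB _ _) _; exact: lerD.
Qed.

Lemma bounded_mfunM f g : bounded_mfun f -> bounded_mfun g ->
  bounded_mfun (fun x => f x * g x).
Proof.
move=> [mf [M fM]] [mg [M' gM']]; split; first exact: measurable_funM.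
by exists (M * M') => x; rewrite normrM; apply: ler_pM.
Qed.

Lemma bounded_mfun_cst c : bounded_mfun (fun=> c).
Proof. by split; [exact: measurable_cst | exists `|c|]. Qed.

Lemma bounded_mfun_sum (I : Type) (s : seq I) (P : pred I) (F : I -> R -> R) :
  (forall i, P i -> bounded_mfun (F i)) ->
  bounded_mfun (fun x => \sum_(i <- s | P i) F i x).
Proof.
move=> hF; elim: s => [|i s IH].
  have -> : (fun x => \sum_(i <- [::] | P i) F i x) = fun=> 0.
    by apply/funext => x; rewrite big_nil.
  exact: bounded_mfun_cst.
have -> : (fun x => \sum_(j <- i :: s | P j) F j x) =
    fun x => (if P i then F i x else 0) + \sum_(j <- s | P j) F j x.
  by apply/funext => x; rewrite big_cons; case: (P i); rewrite ?add0r.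
apply: bounded_mfunD => //; case: (boolP (P i)) => Pi; first exact: hF.
exact: bounded_mfun_cst.
Qed.

Lemma measurable_shift c : measurable_fun [set: R] (fun x : R => x + c).
Proof. by apply: measurable_funD => //; exact: measurable_cst. Qed.

Lemma bounded_mfun_shift c g : bounded_mfun g ->
  bounded_mfun (fun x => g (x + c)).
Proof.
move=> [mg [M gM]]; split; last by exists M.
by apply: (measurableT_comp mg); exact: measurable_shift.
Qed.

Lemma bounded_mfun_bool (p : R -> bool) :
  measurable [set x | p x] -> bounded_mfun (fun x => (p x)%:R).
Proof.
move=> mp; split; last first.
  by exists 1 => x; case: (p x); rewrite ?normr1 ?normr0.
have -> : (fun x => (p x)%:R) = \1_[set x | p x] :> (R -> R).
  by apply/funext => x; rewrite indicE mem_setE.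
exact: measurable_indic.
Qed.

Lemma bounded_mfun_integrable g a b : bounded_mfun g ->
  mu.-integrable `[a, b[ (EFin \o g).
Proof.
move=> [mg [M gM]]; apply: measurable_bounded_integrable => //.
- by rewrite /= lebesgue_measure_itv/=; case: ifP => _; rewrite ?ltry// -EFinD ltry.
- exact: measurable_funTS.
- exists M; split; first exact: num_real.
  by move=> y My x _ /=; apply: le_trans (gM x) (ltW My).
Qed.

Lemma Rintegral_sum (I : Type) (s : seq I) (P : pred I) (F : I -> R -> R) a b :
  (forall i, P i -> bounded_mfun (F i)) ->
  \int[mu]_(x in `[a, b[) (\sum_(i <- s | P i) F i x) =
  \sum_(i <- s | P i) \int[mu]_(x in `[a, b[) F i x.
Proof.
move=> hF; elim: s => [|i s IH].
  rewrite big_nil; under eq_Rintegral do rewrite big_nil.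
  by rewrite Rintegral_cst// mul0r.
rewrite big_cons; under eq_Rintegral do rewrite big_cons.
case: (boolP (P i)) => Pi //.
rewrite RintegralD ?IH//; apply: bounded_mfun_integrable; first exact: hF.
exact: bounded_mfun_sum.
Qed.

Lemma Rintegral_split g a b c : bounded_mfun g -> a <= b -> b <= c ->
  \int[mu]_(x in `[a, c[) g x =
  \int[mu]_(x in `[a, b[) g x + \int[mu]_(x in `[b, c[) g x.
Proof.
move=> hg ab bc.
have E : [set` `[a, c[] = [set` `[a, b[] `|` [set` `[b, c[] :> set R.
  by apply: itv_bndbnd_setU; rewrite bnd_simp.
rewrite E Rintegral_setU//; first by rewrite -E; exact: bounded_mfun_integrable.
apply/disj_setPS => y [/=]; rewrite 2!in_itv/= => /andP[_ yx] /andP[].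
by rewrite leNgt yx.
Qed.

Lemma Rintegral_le f g a b : bounded_mfun f -> bounded_mfun g ->
  (forall x, a <= x < b -> f x <= g x) ->
  \int[mu]_(x in `[a, b[) f x <= \int[mu]_(x in `[a, b[) g x.
Proof.
move=> hf hg fg; apply: le_Rintegral => //; try exact: bounded_mfun_integrable.
Qed.

Lemma Rintegral_nonneg g a b :
  (forall x, a <= x < b -> 0 <= g x) -> 0 <= \int[mu]_(x in `[a, b[) g x.
Proof.
by move=> h; apply: Rintegral_ge0 => x; rewrite /= in_itv/=; exact: h.
Qed.

Lemma Rintegral_eq0 (D : set R) g :
  (forall x, D x -> g x = 0) -> \int[mu]_(x in D) g x = 0.
Proof. by move=> h; rewrite /Rintegral integral0_eq// => x Dx; rewrite h. Qed.

Lemma Rintegral_unit_cst c a : \int[mu]_(x in `[a, a + 1[) c = c.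
Proof.
rewrite Rintegral_cst//= lebesgue_measure_itv/= lte_fin ltrDl ltr01/=.
by rewrite addrAC subrr add0r mulr1.
Qed.

Lemma Rintegral_nat_split g n : bounded_mfun g ->
  \int[mu]_(x in `[0, n%:R]) g x =
  \sum_(k < n) \int[mu]_(x in `[k%:R, k%:R + 1[) g x.
Proof.
move=> hg; rewrite -Rintegral_itv_bndo_bndc; last exact: bounded_mfun_integrable.
elim: n => [|n IH].
  by rewrite big_ord0 set_itv_ge ?bnd_simp ?ltxx// Rintegral_set0.
rewrite big_ord_recr/= -IH -natr1 -Rintegral_split//.
by rewrite lerDl ler01.
Qed.

(** The pushforward under translation agrees with Lebesgue measure on the intervals []a, b]], and
    these determine it. *)
Lemma lebesgue_measure_shift c (A : set R) : measurable A ->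
  mu ((fun x => x + c) @^-1` A) = mu A.
Proof.
move=> mA; apply/esym.
have mshift : measurable_fun [set: measurableTypeR R]
    (fun x : measurableTypeR R => x + c : measurableTypeR R).
  exact: measurable_shift.
pose nu := measure_function_pushforward__canonical__measure_function_Measure
  mu mshift.
suff H : forall X, ocitv X -> mu X = nu X.
  exact: (lebesgue_measure_unique (mu := nu) H).
move=> _ [[a b] _ <-] /=; rewrite /pushforward.
have -> : (fun x : R => x + c) @^-1` [set` `]a, b]] = [set` `]a - c, b - c]].
  by apply/seteqP; split => x /=; rewrite !in_itv/= ltrBlDr lerBrDr.
rewrite !lebesgue_measure_itv/= !lte_fin ltrD2r; case: ifP => // _.
by rewrite -!EFinD; congr EFin; ring.
Qed.

Lemma Rintegral_shift g a b c : bounded_mfun g ->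
  \int[mu]_(x in `[a + c, b + c[) g x = \int[mu]_(x in `[a, b[) g (x + c).
Proof.
move=> hg; rewrite /Rintegral; congr fine.
have E : (fun x : R => x + c) @^-1` [set` `[a + c, b + c[] = [set` `[a, b[].
  by apply/seteqP; split => x /=; rewrite !in_itv/= lerD2r ltrD2r.
rewrite -E.
have mshift : measurable_fun [set: measurableTypeR R]
    (fun x : measurableTypeR R => x + c : measurableTypeR R).
  exact: measurable_shift.
have mg : measurable_fun [set: measurableTypeR R] (EFin \o g).
  by apply/measurable_EFinP; case: hg.
rewrite -(@integral_pushforward _ _ _ _ _ _ mshift (@lebesgue_measure R) _ (EFin \o g) mg)//.
- apply: eq_measure_integral => A mA _.
  exact/esym/lebesgue_measure_shift.
- rewrite E; apply: (@bounded_mfun_integrable (fun x => g (x + c))).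
  exact: bounded_mfun_shift.
Qed.

Lemma Rintegral_unit_shift g c : bounded_mfun g ->
  \int[mu]_(x in `[c, c + 1[) g x = \int[mu]_(x in `[0, 1[) g (x + c).
Proof. by move=> hg; rewrite -Rintegral_shift// add0r [1 + c]addrC. Qed.

(** This turns tightness of an optimality inequality into almost-everywhere information on the
    optimiser. *)
Lemma Rintegral_eq0_null g a b : bounded_mfun g ->
  (forall x, a <= x < b -> 0 <= g x) ->
  \int[mu]_(x in `[a, b[) g x = 0 ->
  mu (`[a, b[ `&` [set x | g x != 0]) = 0%E.
Proof.
move=> hg g0 ig0.
have mg : measurable_fun [set: measurableTypeR R] (EFin \o g).
  by apply/measurable_EFinP; case: hg.
have mD : measurable ([set` `[a, b[] : set (measurableTypeR R)) by [].
have H : (\int[mu]_(x in `[a, b[) `|(g x)%:E| = 0)%E.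
  transitivity (\int[mu]_(x in `[a, b[) (g x)%:E)%E.
    apply: eq_integral => x; rewrite inE/= in_itv/= => /g0 gx.
    by rewrite ger0_norm.
  have := integrable_fin_num mD (bounded_mfun_integrable g a b hg).
  by move=> /fineK <-; congr EFin.
have [N [mN N0 sub]] := (ae_eq_integral_abs mu mD (measurable_funTS mg)).1 H.
have mS : measurable (`[a, b[ `&` [set x | g x != 0] : set R).
  rewrite [X in measurable (_ `&` X)](_ : _ = g @^-1` [set~ 0]); last first.
    by apply/seteqP; split => x /= /eqP.
  apply: measurableI => //; rewrite -[X in measurable X]setTI.
  by apply: (hg.1) => //; exact: measurableC.
apply/eqP; rewrite eq_le measure_ge0 andbT -N0; apply: le_measure; rewrite ?inE//.
apply: subset_trans sub => x [/= xD gx] H'.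
by move: (H' xD) => [] /eqP; rewrite (negbTE gx).
Qed.

(** A candidate constant [c] differs from [u] or from [v]. On the corresponding side of [x], an
    interval of positive length would be covered by two null sets. *)
Lemma not_locally_ae_const {X : Type} (g : R -> X) (u v : X) x :
  (forall c : X, measurable [set y | g y = c]) -> u <> v ->
  mu (`[x - 1, x[ `&` [set y | g y <> u]) = 0%E ->
  mu (`[x, x + 1[ `&` [set y | g y <> v]) = 0%E ->
  ~ locally_ae_const g x.
Proof.
move=> mg uv gu gv [d d0 [c gc]].
have mgC (w : X) : measurable [set y | g y <> w].
  by rewrite -[X in measurable X]/(~` [set y | g y = w]); exact: measurableC.
have mC : measurable [set y | x - d < y < x + d /\ g y <> c].
  rewrite [X in measurable X](_ : _ = `]x - d, x + d[ `&` [set y | g y <> c]).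
    exact: measurableI.
  by apply/seteqP; split => y /=; rewrite in_itv.
have mI a b w : measurable (`[a, b[ `&` [set y | g y <> w]) by exact: measurableI.
have key a b w : x - d <= a -> a < b -> b <= x + d -> c <> w ->
    mu (`[a, b[ `&` [set y | g y <> w]) = 0%E -> False.
  move=> da ab bd cw gw.
  have sub : `]a, b[ `<=` (`[a, b[ `&` [set y | g y <> w]) `|`
      [set y | x - d < y < x + d /\ g y <> c].
    move=> y /=; rewrite !in_itv/= => /andP[ay yb].
    have [gyw|gyw] := pselect (g y = w); [right | left].
      by split; [apply/andP; split; lra | rewrite gyw => /esym].
    by split => //; rewrite (ltW ay).
  have : (mu `]a, b[ <= 0)%E.
    apply: (@le_trans _ _ (mu ((`[a, b[ `&` [set y | g y <> w]) `|`
      [set y | x - d < y < x + d /\ g y <> c]))).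
      apply: le_measure => //; rewrite inE//; apply: measurableU => //; exact: mI.
    apply: (le_trans (measureU2 _ _ _)) => //; first exact: mI.
    by rewrite -[leRHS]adde0; apply: leeD; [rewrite -gw | rewrite -gc].
  rewrite lebesgue_measure_itv/= lte_fin ab -EFinD lee_fin; lra.
(* For [c = u] the contradiction arises to the right of [x], otherwise to the left. The minimum and
   maximum keep the interval within distance 1 and [d] of [x]. *)
have [cu|cu] := pselect (c = u).
- pose b := Num.min (x + 1) (x + d).
  have b1 : b <= x + 1 by rewrite /b ge_min lexx.
  have b2 : b <= x + d by rewrite /b ge_min lexx orbT.
  have b3 : x < b by rewrite /b lt_min; apply/andP; split; lra.
  apply: (key x b v) => //; [lra | by rewrite cu |].
  apply/eqP; rewrite eq_le measure_ge0 andbT -gv.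
  apply: le_measure; rewrite ?inE; [exact: mI | exact: mI |].
  by move=> y [/=]; rewrite !in_itv/= => /andP[? ?] ?; split => //; apply/andP; split; lra.
- pose a := Num.max (x - 1) (x - d).
  have a1 : x - 1 <= a by rewrite /a le_max lexx.
  have a2 : x - d <= a by rewrite /a le_max lexx orbT.
  have a3 : a < x by rewrite /a gt_max; apply/andP; split; lra.
  apply: (key a x u) => //; [lra|].
  apply/eqP; rewrite eq_le measure_ge0 andbT -gu.
  apply: le_measure; rewrite ?inE; [exact: mI | exact: mI |].
  by move=> y [/=]; rewrite !in_itv/= => /andP[? ?] ?; split => //; apply/andP; split; lra.
Qed.

End BoundedMeasurable.

(** * The alternating pattern of arrival times along the chain *)

Section Pulse.
Context {R : realType}.
Implicit Types (x : R) (i k n : nat).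

(** The times at which flow leaving s during [0, 1) can be at v_i. The recursion follows the two
    edges into v_i, of transit times 0 and [2 ^ i]. *)
Fixpoint pulse i x : bool :=
  if i is j.+1 then pulse j x || pulse j (x - (2 ^ i)%:R) else 0 <= x < 1.

Lemma pulse_bounds {i x} : pulse i x -> 0 <= x < (2 ^ i.+1)%:R.
Proof.
elim: i x => [|i IH] x /=; first by move=> /andP[x0 x1]; rewrite x0/=; lra.
have -> : (2 ^ i.+2)%:R = (2 ^ i.+1)%:R + (2 ^ i.+1)%:R :> R.
  by rewrite -natrD addnn -mul2n -expnS.
have p0 : 0 < (2 ^ i.+1)%:R :> R by rewrite ltr0n expn_gt0.
by move=> /orP[] /IH /andP[a b]; apply/andP; split; lra.
Qed.

(** The delayed copy starts only after the undelayed one has ended, so the disjunction is a genuine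
    sum. Flow conservation needs this additive form. *)
Lemma pulseS i x : (pulse i.+1 x)%:R =
  (pulse i x)%:R + (pulse i (x - (2 ^ i.+1)%:R))%:R :> R.
Proof.
rewrite /=; case: (boolP (pulse i x)) => [/pulse_bounds/andP[_ a]|_]; last by rewrite add0r.
case: (boolP (pulse i _)) => [/pulse_bounds/andP[b _]|_]; last by rewrite addr0.
by exfalso; lra.
Qed.

(** In the lower half of the range of [k] only the undelayed copy is active, in the upper half only
    the delayed one. The delay is even, so parity is preserved. *)
Lemma pulse_addn i k x : 0 <= x < 1 -> (k < 2 ^ i.+1)%N ->
  pulse i (x + k%:R) = ~~ odd k.
Proof.
move=> /andP[x0 x1]; elim: i k => [|i IH] k.
  case: k => [|[|k]] //= _; first by rewrite addr0 x0.
  by apply/negbTE/negP => /andP[_]; lra.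
move=> kn /=; case: (ltnP k (2 ^ i.+1)) => kl.
  rewrite IH//; case: (boolP (pulse i _)); last by rewrite orbF.
  move=> /pulse_bounds/andP[+ _]; move: kl; rewrite -(ltr_nat R) => kl b.
  have : (k.+1%:R : R) <= (2 ^ i.+1)%:R by rewrite ler_nat -(ltr_nat R).
  by rewrite -natr1 => ?; exfalso; lra.
have -> : pulse i (x + k%:R) = false.
  apply/negbTE/negP => /pulse_bounds/andP[_]; apply/negP; rewrite -leNgt.
  by rewrite -(ler_nat R) in kl; lra.
rewrite /= -addrA -natrB// IH; last by move: kn; rewrite (expnS _ i.+1); lia.
by rewrite oddB// oddX orbF addbF.
Qed.

Lemma measurable_pulse i : measurable [set x | pulse i x].
Proof.
elim: i => [|i IH] /=.
  suff -> : [set x | 0 <= x < 1] = [set` `[0 : R, 1[] by [].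
  by apply/seteqP; split => x /=; rewrite in_itv.
have -> : [set x | pulse i x || pulse i (x - (2 ^ i.+1)%:R)] =
    [set x | pulse i x] `|`
    (fun x => x + - (2 ^ i.+1)%:R) @^-1` [set x | pulse i x].
  by apply/seteqP; split => x /=; [move=> /orP | move=> H; apply/orP].
apply: measurableU => //; rewrite -[X in measurable X]setTI.
exact: measurable_shift.
Qed.

Lemma sum_even n : (\sum_(k < n.*2) (~~ odd k)%:R = n%:R :> R).
Proof.
elim: n => [|n IH]; first by rewrite big_ord0.
by rewrite doubleS !big_ord_recr/= IH odd_double/= addr0 natr1.
Qed.

Lemma Rintegral_pulse i :
  \int[lebesgue_measure]_(x in `[0, (2 ^ i.+1)%:R]) (pulse i x)%:R = (2 ^ i)%:R :> R.
Proof.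
have hp : bounded_mfun (fun x => (pulse i x)%:R).
  by apply: bounded_mfun_bool; exact: measurable_pulse.
rewrite Rintegral_nat_split// -sum_even -mul2n -expnS.
apply: eq_bigr => k _; rewrite Rintegral_unit_shift//.
rewrite -[RHS](Rintegral_unit_cst _ 0) add0r.
apply: eq_Rintegral => x; rewrite inE/= in_itv/= => xx.
by rewrite pulse_addn.
Qed.
End Pulse.

(** * The network, its incidences and its admissibility *)

Section Network.
Context (R : realType) (l : nat).

Lemma edge_ltn (e : 'I_(l.*2.+2)) : (uphalf e < l.+2)%N.
Proof. by case: e => k /= hk; lia. Qed.

Definition vtx (m : nat) : 'I_l.+3 := inord m.

(** One more than the optimum [2 ^ l]: cutting one such edge at a single time [x + k] already makes
    the times over [x] too expensive. *)
Definition large_cap : R := (2 ^ l)%:R + 1.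

(* Vertex 0 is s, vertex i.+1 is v_i and vertex l.+2 is t.  Edge 0 is s -> v_0,
   edges i.*2.+1 and i.*2.+2 join v_i to v_(i+1), and edge l.*2.+1 is v_l -> t. *)
Definition pulse_network : network R :=
  @Network R l.+3 l.*2.+2
    (fun e => vtx (uphalf e)) (fun e => vtx (uphalf e).+1) (vtx 0) (vtx l.+2)
    (2 ^ l.+1)%:R
    (fun e => if odd e || (e == 0 :> nat) then 0 else (2 ^ e./2)%:R)
    (fun e x => if e == 0 :> nat then (if x < 1 then large_cap else 0)
                else if e == l.*2.+1 :> nat then 1 else large_cap).

Local Notation N := pulse_network.
Local Notation T := ((2 ^ l.+1)%:R : R).
Local Notation mu := (@lebesgue_measure R).

Definition edge (k : nat) : 'I_(ne N) := inord k.

Lemma val_vtx m : (m < l.+3)%N -> vtx m = m :> nat.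
Proof. by move=> h; rewrite /vtx inordK. Qed.

Lemma val_edge k : (k < l.*2.+2)%N -> edge k = k :> nat.
Proof. by move=> h; rewrite /edge inordK. Qed.

Lemma vtx_eq m (v : 'I_l.+3) : (m < l.+3)%N -> (vtx m == v) = (m == v :> nat).
Proof. by move=> h; rewrite -val_eqE/= val_vtx. Qed.

Lemma tlE e (v : 'I_(nv N)) : (tl N e == v) = (uphalf e == v :> nat).
Proof. by rewrite /= vtx_eq//; have := edge_ltn e; lia. Qed.

Lemma hdE e (v : 'I_(nv N)) : (hd N e == v) = ((uphalf e).+1 == v :> nat).
Proof. by rewrite /= vtx_eq//; have := edge_ltn e; lia. Qed.

Lemma sum_edge0 (F : 'I_(ne N) -> R) :
  \sum_(e : 'I_(ne N) | uphalf e == 0%N) F e = F (edge 0).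
Proof.
rewrite (big_pred1 (edge 0))// => e /=; rewrite -val_eqE/= val_edge//.
by case: e => k /= _; lia.
Qed.

Lemma sum_edge_last (F : 'I_(ne N) -> R) :
  \sum_(e : 'I_(ne N) | uphalf e == l.+1%N) F e = F (edge l.*2.+1).
Proof.
rewrite (big_pred1 (edge l.*2.+1))// => e /=; rewrite -val_eqE/= val_edge//.
by case: e => k /= hk; lia.
Qed.

Lemma sum_edge_mid m (F : 'I_(ne N) -> R) : (0 < m <= l)%N ->
  \sum_(e : 'I_(ne N) | uphalf e == m%N) F e = F (edge m.*2.-1) + F (edge m.*2).
Proof.
move=> hm; have h1 : (m.*2.-1 < l.*2.+2)%N by lia.
have h2 : (m.*2 < l.*2.+2)%N by lia.
rewrite (bigD1 (edge m.*2.-1))/=; last by rewrite val_edge//; lia.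
rewrite (bigD1 (edge m.*2))/=; last first.
  by rewrite -val_eqE/= !val_edge//; lia.
rewrite big_pred0 ?addr0// => e.
by rewrite -!val_eqE/= !val_edge//; case: e => k /= hk; lia.
Qed.

Lemma pulse_network_valid : valid_network N.
Proof.
have b0 : 0 <= large_cap by rewrite /large_cap addr_ge0.
split; first by rewrite /= vtx_eq// val_vtx.
split; first by rewrite /= ler0n.
split=> [e|e x _] /=; first by case: ifP => _; rewrite ?ler0n.
by case: ifP => _; case: ifP.
Qed.

(** Every edge raises the vertex number by one. *)
Lemma pulse_network_acyclic : acyclic_network N.
Proof.
move=> e0 p; suff H : path (fun e1 e2 => hd N e1 == tl N e2) e0 p ->
    (uphalf e0 <= uphalf (last e0 p))%N.
  move=> /H hp; rewrite hdE/= val_vtx; first by lia.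
  by have := edge_ltn e0; lia.
elim: p e0 => [|e p IH] e0 //= /andP[+ /IH].
rewrite -/(hd N e0) hdE/= val_vtx; first by lia.
by have := edge_ltn e; lia.
Qed.

Lemma pulse_network_one_change :
  exists (e0 : 'I_(ne N)) (theta0 a b delta : R),
    one_capacity_change_at N e0 theta0 a b /\ 0 < delta /\
    integer_multiple delta (horizon N) /\
    (forall e, integer_multiple delta (transit N e)) /\
    integer_multiple delta theta0.
Proof.
have b0 : 0 < large_cap by rewrite /large_cap ltr_wpDl.
(* The edge out of s drops from [large_cap] to 0 at time 1; all times are integers, hence the unit
   1. *)
exists (edge 0), 1, large_cap, 0, 1; split; [|split; [|split; [|split]]] => //.
- split; first by rewrite /= ltr01 ltr1n expnS; have := expn_gt0 2 l; lia.
  split; first by rewrite gt_eqF.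
  split; first by move=> x; rewrite /= val_edge.
  move=> e; rewrite -val_eqE/= val_edge// => /negbTE e0.
  rewrite e0; case: ifP => _; by [exists 1 | exists large_cap].
- by exists (2 ^ l.+1)%N; rewrite mulr1.
- move=> e /=; case: ifP => _; first by exists 0; rewrite mul0r.
  by exists (2 ^ e./2)%N; rewrite mulr1.
- by exists 1; rewrite mulr1.
Qed.

Lemma tl_edge k : (k < l.*2.+2)%N -> tl N (edge k) = vtx (uphalf k).
Proof. by move=> h; rewrite /= val_edge. Qed.

Lemma hd_edge k : (k < l.*2.+2)%N -> hd N (edge k) = vtx (uphalf k).+1.
Proof. by move=> h; rewrite /= val_edge. Qed.

(** Transit times as natural numbers, so that their parity can be used. *)
Definition transit_nat (k : nat) : nat :=
  (if odd k || (k == 0) then 0 else 2 ^ k./2)%N.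

Lemma transitE e : transit N e = (transit_nat e)%:R.
Proof. by rewrite /= /transit_nat; case: ifP. Qed.

Lemma odd_transit_nat k : odd (transit_nat k) = false.
Proof.
rewrite /transit_nat; case: ifP => //= h; rewrite oddX.
by have -> : (k./2 == 0)%N = false by lia.
Qed.

Lemma bounded_mfun_cap e : bounded_mfun (cap N e).
Proof.
rewrite /=; case: (e == 0 :> nat); last first.
  by case: (e == l.*2.+1 :> nat); exact: bounded_mfun_cst.
have -> : (fun x => if x < 1 then large_cap else 0) =
    (fun x : R => large_cap * (x < 1)%R%:R).
  by apply/funext => x; case: ifP; rewrite ?mulr1 ?mulr0.
apply: bounded_mfunM; first exact: bounded_mfun_cst.
apply: bounded_mfun_bool.
suff -> : [set x : R | x < 1] = [set` `]-oo, 1[] by [].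
by apply/seteqP; split => x /=; rewrite in_itv.
Qed.

Lemma large_cap_ge1 : 1 <= large_cap.
Proof. by rewrite /large_cap lerDr. Qed.

Lemma cap_ge0 e x : 0 <= cap N e x.
Proof.
have := large_cap_ge1 => b1.
by rewrite /=; case: ifP => _; case: ifP => // _; apply: le_trans b1.
Qed.

Lemma cap_le e x : cap N e x <= large_cap.
Proof.
have := large_cap_ge1 => b1.
by rewrite /=; case: ifP => _; case: ifP => // _; apply: le_trans b1.
Qed.

Lemma cap_last x : cap N (edge l.*2.+1) x = 1.
Proof. by rewrite /= val_edge// eqxx. Qed.

Lemma transit_last : transit N (edge l.*2.+1) = 0.
Proof. by rewrite transitE val_edge// /transit_nat /= odd_double. Qed.

Lemma tl_last : tl N (edge l.*2.+1) = vtx l.+1.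
Proof. by rewrite tl_edge//; congr vtx; lia. Qed.

Lemma hd_last : hd N (edge l.*2.+1) = snk N.
Proof. by rewrite hd_edge//; congr vtx; lia. Qed.

Lemma horizon_fiber x k : 0 <= x < 1 -> (k < 2 ^ l.+1)%N -> 0 <= x + k%:R <= T.
Proof.
move=> /andP[x0 x1] kT; rewrite addr_ge0//=.
have : (k.+1%:R : R) <= T by rewrite ler_nat.
by rewrite -natr1; lra.
Qed.

(** * Lower bound on the capacity of an arbitrary cut *)

Section Cut.
Variable S : 'I_(nv N) -> R -> bool.
Hypothesis cutS : is_dyn_cut N S.

Let mS v : measurable [set x | S v x]. Proof. by case: cutS. Qed.

Let S_src x : 0 <= x <= T -> S (vtx 0) x.
Proof. by case: cutS => _ [+ _] => /(_ x). Qed.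

Let S_snk x : 0 <= x <= T -> ~~ S (snk N) x.
Proof. by case: cutS => _ [_ [+ _]] => /(_ x). Qed.

Definition cut_edge e x := S (tl N e) x && ~~ S (hd N e) (x + transit N e).

Definition cut_rate x := \sum_(e | cut_edge e x) cap N e x.

Lemma bounded_mfun_cut_rate : bounded_mfun cut_rate.
Proof.
have -> : cut_rate = fun x => \sum_e (cut_edge e x)%:R * cap N e x.
  apply/funext => x; rewrite /cut_rate big_mkcond; apply: eq_bigr => e _.
  by case: ifP; rewrite ?mul1r ?mul0r.
apply: bounded_mfun_sum => e _; apply: bounded_mfunM; last exact: bounded_mfun_cap.
apply: bounded_mfun_bool.
have -> : [set x | cut_edge e x] = [set x | S (tl N e) x] `&`
    ~` ((fun x => x + transit N e) @^-1` [set x | S (hd N e) x]).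
  by apply/seteqP; split => x /=; [move=> /andP[-> /negP] | move=> [a /negP b]; apply/andP].
apply: measurableI => //; apply: measurableC; rewrite -[X in measurable X]setTI.
exact: measurable_shift.
Qed.

Lemma cut_capacityE : cut_capacity N S =
  (\int[mu]_(x in `[0, T]) cut_rate x)%:E.
Proof.
rewrite /Rintegral fineK//.
rewrite -integral_itv_bndo_bndc.
  exact: (integrable_fin_num _ (bounded_mfun_integrable _ _ _ bounded_mfun_cut_rate)).
by apply/measurable_EFinP/measurable_funTS; case: bounded_mfun_cut_rate.
Qed.

(** Folding the horizon onto [0, 1) allows a pointwise bound on each fiber, that is, on the times
    [x + k] for a fixed [x]. *)
Lemma cut_capacity_fiber : cut_capacity N S =
  (\int[mu]_(x in `[0, 1[) \sum_(k < 2 ^ l.+1) cut_rate (x + k%:R))%:E.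
Proof.
have h := bounded_mfun_cut_rate.
rewrite cut_capacityE Rintegral_nat_split// Rintegral_sum; last first.
  by move=> k _; exact: bounded_mfun_shift.
by congr EFin; apply: eq_bigr => k _; rewrite Rintegral_unit_shift.
Qed.

Definition good_fiber x :=
  [forall k : 'I_(2 ^ l.+1), S (vtx l.+1) (x + k%:R) == ~~ odd k].

Lemma cut_rate_ge e x : cut_edge e x -> cap N e x <= cut_rate x.
Proof.
move=> ce; rewrite /cut_rate (bigD1 e)//= lerDl sumr_ge0// => i _.
exact: cap_ge0.
Qed.

Lemma cut_rate_ge0 x : 0 <= cut_rate x.
Proof. by apply: sumr_ge0 => e _; exact: cap_ge0. Qed.

Lemma cut_rate_ge_last x : 0 <= x <= T -> (S (vtx l.+1) x)%:R <= cut_rate x.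
Proof.
move=> xT; case: (boolP (S _ x)) => Sx; last exact: cut_rate_ge0.
rewrite -(cap_last x); apply: cut_rate_ge.
by rewrite /cut_edge tl_last Sx hd_last transit_last addr0 S_snk.
Qed.

(** A cut edge of capacity [large_cap] pays for everything at once. Otherwise the source side
    propagates to v_l at every even [k], so a deviation can only be an additional odd [k], which the
    last edge also charges. *)
Lemma cut_fiber_ge x : 0 <= x < 1 ->
  (2 ^ l)%:R + (~~ good_fiber x)%:R <= \sum_(k < 2 ^ l.+1) cut_rate (x + k%:R).
Proof.
move=> x01; have [x0 x1] := andP x01.
(* The edge out of s counts only for [k = 0], since its capacity vanishes at the other times of the
   fiber. *)
case: (boolP [exists k : 'I_(2 ^ l.+1), [exists e : 'I_(ne N),
  [&& (e != l.*2.+1 :> nat), (e == 0 :> nat) ==> (k == 0 :> nat) &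
      cut_edge e (x + k%:R)]]]) => [/existsP[k /existsP[e /and3P[el e0 ce]]]|nocut].
  rewrite (bigD1 k)//=; apply: ler_wpDr.
    by apply: sumr_ge0 => i _; exact: cut_rate_ge0.
  apply: le_trans (cut_rate_ge _ _ ce).
  suff -> : cap N e (x + k%:R) = large_cap.
    by rewrite /large_cap lerD2l; case: good_fiber.
  rewrite /= (negbTE el); case: eqP => // e00.
  by move: e0; rewrite e00 /= => /eqP ->; rewrite addr0 x1.
(* With no such cut edge, the source side is closed under travelling along these edges. *)
have step e k : (k < 2 ^ l.+1)%N -> (e < l.*2.+1)%N -> ((e == 0) ==> (k == 0))%N ->
    S (vtx (uphalf e)) (x + k%:R) ->
    S (vtx (uphalf e).+1) (x + (k + transit_nat e)%N%:R).
  move=> kT eT e0 Se; apply/negPn/negP => Se'; case/negP: nocut.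
  have eT' : (e < l.*2.+2)%N by lia.
  apply/existsP; exists (Ordinal kT); apply/existsP; exists (edge e).
  rewrite val_edge// e0 /cut_edge tl_edge// hd_edge// transitE val_edge//= Se.
  by rewrite -addrA -natrD Se' !andbT; lia.
(* The binary digits of [k] choose the route: the leading one decides between the fast and the slow
   edge into the last vertex. *)
have reach i k : (i <= l)%N -> (k < 2 ^ i.+1)%N -> ~~ odd k ->
    S (vtx i.+1) (x + k%:R).
  elim: i k => [|i IH] k il kT ok.
    have -> : k = 0%N by move: k kT ok => [|[|]].
    apply: (step 0%N 0%N) => //; first by rewrite expn_gt0.
    by apply: S_src; apply: horizon_fiber => //; rewrite expn_gt0.
  have le2 : (2 ^ i.+2 <= 2 ^ l.+1)%N by rewrite leq_exp2l.
  case: (ltnP k (2 ^ i.+1)) => kl.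
    have := step i.*2.+1 k; have -> : (uphalf i.*2.+1 = i.+1)%N by lia.
    rewrite /transit_nat [odd _]/= odd_double addn0.
    by apply => //; [lia | lia | exact: IH (ltnW il) kl ok].
  have kE : (k - 2 ^ i.+1 + 2 ^ i.+1 = k)%N by lia.
  have := step i.+1.*2 (k - 2 ^ i.+1)%N; rewrite /transit_nat odd_double orFb.
  have -> : (i.+1.*2 == 0)%N = false by lia.
  have -> : (i.+1.*2./2 = i.+1)%N by lia.
  have -> : (uphalf i.+1.*2 = i.+1)%N by lia.
  rewrite kE; apply => //; [lia | lia |].
  apply: IH; [lia | by move: kT; rewrite (expnS _ i.+1); lia |].
  by rewrite oddB// oddX addbF.
have geS : \sum_(k < 2 ^ l.+1) (S (vtx l.+1) (x + k%:R))%:R <=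
    \sum_(k < 2 ^ l.+1) cut_rate (x + k%:R) :> R.
  by apply: ler_sum => k _; apply: cut_rate_ge_last; exact: horizon_fiber.
apply: le_trans geS; rewrite -sum_even -mul2n -expnS.
have le1 (k : 'I_(2 ^ l.+1)) : (~~ odd k)%:R <= (S (vtx l.+1) (x + k%:R))%:R :> R.
  by case: (boolP (~~ odd k)) => // ok; rewrite reach.
case: (boolP (good_fiber x)) => [_|/forallPn[k0 /eqP bad]].
  by rewrite addr0; apply: ler_sum.
(* By [reach], the deviating index [k0] is odd; its term supplies the additional 1. *)
rewrite (bigD1 k0)// [leRHS](bigD1 k0)//= addrAC.
apply: lerD; last by apply: ler_sum.
move: bad; case: (boolP (~~ odd k0)) => ok; first by rewrite reach.
by case: (S _ _) => //; rewrite add0r.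
Qed.

Lemma bounded_mfun_good : bounded_mfun (fun x => (~~ good_fiber x)%:R).
Proof.
apply: bounded_mfun_bool.
have -> : [set x | ~~ good_fiber x] = ~` \big[setI/setT]_(k < 2 ^ l.+1)
    ((fun x => x + k%:R) @^-1` [set x | S (vtx l.+1) x == ~~ odd k]).
  apply/seteqP; split => x /=.
    move=> /negP bad all; apply: bad; apply/forallP => k.
    by move: all; rewrite (bigD1 k)//= => -[].
  move=> bad; apply/negP => /forallP good; apply: bad.
  by elim/big_ind: _ => // k _; exact: good.
apply: measurableC; apply: bigsetI_measurable => k _.
rewrite -[X in measurable X]setTI; apply: measurable_shift => //.
case: (odd k) => /=.
  have -> : [set x | S (vtx l.+1) x == false] = ~` [set x | S (vtx l.+1) x].
    by apply/seteqP; split => x /=; [move=> /eqP -> | move=> /negP/negbTE ->].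
  exact: measurableC.
have -> : [set x | S (vtx l.+1) x == true] = [set x | S (vtx l.+1) x].
  by apply/seteqP; split => x /=; [move=> /eqP -> | move=> ->].
exact: mS.
Qed.

(** Integrating the fiber bound makes a cut pay for the measure of its bad fibers on top of
    [2 ^ l]. *)
Lemma cut_capacity_ge :
  (((2 ^ l)%:R + \int[mu]_(x in `[0, 1[) (~~ good_fiber x)%:R)%:E
     <= cut_capacity N S)%E.
Proof.
have h := bounded_mfun_cut_rate; have hg := bounded_mfun_good.
rewrite cut_capacity_fiber lee_fin.
rewrite -{1}(Rintegral_unit_cst (2 ^ l)%:R 0) add0r.
rewrite -RintegralD//; try exact: bounded_mfun_integrable.
- apply: Rintegral_le => //; last exact: cut_fiber_ge.
  + by apply: bounded_mfunD => //; exact: bounded_mfun_cst.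
  + by apply: bounded_mfun_sum => k _; exact: bounded_mfun_shift.
- by apply: (@bounded_mfun_integrable _ (fun=> (2 ^ l)%:R)); exact: bounded_mfun_cst.
Qed.

End Cut.

(** * A cut of capacity at most [2 ^ l], and the complexity of every minimum cut *)

(** The source side consists of what is reachable from s; [v.-1] turns a vertex number into the
    index of v_i, and the first disjunct is the convention after the horizon. *)
Definition pulse_cut (v : 'I_(nv N)) (x : R) : bool :=
  (T < x) || (v == 0 :> nat) || ((v != l.+2 :> nat) && pulse v.-1 x).

Lemma pulse_cut_is_cut : is_dyn_cut N pulse_cut.
Proof.
split; [|split; [|split]].
- move=> v; have -> : [set x | pulse_cut v x] = [set` `]T, +oo[] `|`
      [set x | (v == 0 :> nat) || ((v != l.+2 :> nat) && pulse v.-1 x)].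
    apply/seteqP; split => x /=; rewrite in_itv/= andbT /pulse_cut -orbA.
      by move/orP.
    by move=> H; apply/orP.
  apply: measurableU => //; case: eqP => _ //=.
    by rewrite [X in measurable X](_ : _ = setT)//; apply/seteqP; split.
  case: eqP => _ /=; last exact: measurable_pulse.
  by rewrite [X in measurable X](_ : _ = set0)//; apply/seteqP; split.
- by move=> x _; rewrite /pulse_cut val_vtx//= orbT.
- by move=> x /andP[_ xT]; rewrite /pulse_cut ltNge xT /= val_vtx// eqxx.
- by move=> v x xT; rewrite /pulse_cut xT.
Qed.

(** Reachability propagates along the parallel edges, so these are never cut. The edge out of s is
    cut only from time 1 on, when its capacity is 0. *)
Lemma pulse_cut_rate (x : R) : 0 <= x <= T -> cut_rate pulse_cut x <= (pulse l x)%:R.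
Proof.
move=> /andP[x0 xT].
have xTF : (T < x) = false by rewrite ltNge xT.
have nomid (e : 'I_(ne N)) : (0 < e < l.*2.+1)%N -> ~~ cut_edge pulse_cut e x.
  move=> he; rewrite /cut_edge negb_and negbK -implybE; apply/implyP.
  have h1 : ((uphalf e).+1 < l.+3)%N := edge_ltn e.
  have h2 : (uphalf e < l.+3)%N := ltnW h1.
  rewrite /pulse_cut /= !val_vtx//.
  have -> : (uphalf e == 0)%N = false by lia.
  rewrite xTF !orFb => /andP[_]; set m := uphalf e => pm.
  have -> : (m.+1 == 0)%N = false by lia.
  have -> : (m.+1 != l.+2)%N by rewrite /m; lia.
  apply/orP; right => /=; have mE : m = m.-1.+1 by rewrite /m; lia.
  rewrite mE /=; apply/orP.
  (* The fast edge realises the first disjunct of [pulse], the slow edge the delayed one. *)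
  have [oe|oe] := boolP (odd e); first by left; rewrite /= addr0.
  right; rewrite -mE.
  have -> : (e == 0 :> nat)%N = false by lia.
  have -> : e./2 = m by rewrite /m; lia.
  by rewrite /= addrK.
rewrite /cut_rate big_mkcond (bigD1 (edge l.*2.+1))//=.
rewrite big1 ?addr0 => [|e].
  have -> : cut_edge pulse_cut (edge l.*2.+1) x =
      pulse l x && ~~ pulse_cut (snk N) (x + 0).
    rewrite /cut_edge tl_last hd_last transit_last /pulse_cut xTF val_vtx//.
    by have -> : (l.+1 != l.+2)%N by lia.
  rewrite val_edge//= eqxx.
  by case: (pulse l x) => //; case: (_ && _).
rewrite -val_eqE/= val_edge// => el; case: ifP => // ce.
have [e0|e0] := eqVneq (e : nat) 0%N; last first.
  by move: (nomid e); rewrite ce; case: e el {ce} e0 => k /= hk *; lia.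
case: ifP => // x1; move: ce; rewrite /cut_edge /= e0 /= addr0 /pulse_cut !val_vtx//=.
by rewrite x0 x1 /= !orbT.
Qed.

Lemma pulse_cut_capacity : (cut_capacity N pulse_cut <= (2 ^ l)%:R%:E)%E.
Proof.
have hp : bounded_mfun (fun x : R => (pulse l x)%:R).
  by apply: bounded_mfun_bool; exact: measurable_pulse.
have hc := bounded_mfun_cut_rate pulse_cut pulse_cut_is_cut.
rewrite cut_capacityE; last exact: pulse_cut_is_cut.
rewrite lee_fin -(Rintegral_pulse l).
rewrite -!Rintegral_itv_bndo_bndc; try exact: bounded_mfun_integrable.
apply: Rintegral_le => // x /andP[x0 x1]; apply: pulse_cut_rate.
by rewrite x0 ltW.
Qed.

(** Comparison with [pulse_cut] leaves no room for bad fibers beyond a null set, so v_l alternates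
    almost everywhere. *)
Lemma min_cut_complexity S : is_min_dyn_cut N S -> cut_complexity_ge N S (2 ^ l).
Proof.
move=> [cutS minS].
have hg := bounded_mfun_good S cutS.
have mS := cutS.1 (vtx l.+1).
have bad0 : \int[mu]_(x in `[0, 1[) (~~ good_fiber S x)%:R = 0 :> R.
  have := le_trans (cut_capacity_ge S cutS)
    (le_trans (minS _ pulse_cut_is_cut) pulse_cut_capacity).
  rewrite lee_fin gerDl => b0; apply/eqP; rewrite eq_le b0/=.
  by apply: Rintegral_nonneg.
have mEq (c : bool) : measurable [set y | S (vtx l.+1) y = c].
  case: c => //.
  have -> : [set y | S (vtx l.+1) y = false] = ~` [set x | S (vtx l.+1) x].
    by apply/seteqP; split => x /=; [move=> -> | move=> /negP/negbTE].
  exact: measurableC.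
have fib k : (k < 2 ^ l.+1)%N ->
    mu (`[k%:R, k%:R + 1[ `&` [set y | S (vtx l.+1) y <> ~~ odd k]) = 0%E.
  move=> kT; pose g (y : R) : R := (S (vtx l.+1) y != ~~ odd k)%:R.
  have mg : bounded_mfun g.
    apply: bounded_mfun_bool.
    have -> : [set y | S (vtx l.+1) y != ~~ odd k] =
        ~` [set y | S (vtx l.+1) y = ~~ odd k].
      by apply/seteqP; split => y /= /eqP.
    exact: measurableC.
  have := Rintegral_eq0_null g k%:R (k%:R + 1) mg.
  have -> : [set x | g x != 0] = [set y | S (vtx l.+1) y <> ~~ odd k].
    have gE y : (g y != 0) = (S (vtx l.+1) y != ~~ odd k).
      by rewrite /g; case: (S _ y == _); rewrite ?eqxx ?oner_eq0.
    by apply/seteqP; split => y /=; rewrite gE => /eqP.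
  apply; first by move=> x _; rewrite /g ler0n.
  apply/eqP; rewrite eq_le; apply/andP; split; last first.
    by apply: Rintegral_nonneg => x _; rewrite /g ler0n.
  (* A deviation at [x + k] makes the whole fiber of [x] bad. *)
  rewrite Rintegral_unit_shift// -[leRHS]bad0; apply: Rintegral_le => //.
    exact: bounded_mfun_shift.
  move=> x x01; rewrite /g; case: (boolP (good_fiber S x)) => [/forallP|_].
    by move=> /(_ (Ordinal kT)) /= ->.
  by case: (_ != _).
(* The odd integers alone give enough changes: v_l is on the source side just before each and off it
   just after. *)
exists [seq (vtx l.+1, (j.*2.+1)%:R : R) | j <- iota 0 (2 ^ l)]; split; [|split].
- rewrite map_inj_uniq ?iota_uniq// => i j [] /eqP; rewrite eqr_nat => /eqP; lia.
- by rewrite size_map size_iota.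
- move=> p /mapP[j]; rewrite mem_iota /= add0n => jl -> /=; split.
    by rewrite ltr0n.
  have e1 : (j.*2.+1)%:R - 1 = (j.*2)%:R :> R by rewrite -natr1 addrK.
  have l2 : (2 ^ l.+1 = (2 ^ l).*2)%N by rewrite expnS mul2n.
  apply: (@not_locally_ae_const _ _ _ true false) => //.
  + have := fib j.*2; rewrite odd_double /= natr1 e1; apply; lia.
  + have := fib j.*2.+1; rewrite /= odd_double /=; apply; lia.
Qed.

(** * Bounds on an arbitrary flow *)

Lemma hd_snkE (e : 'I_(ne N)) : (hd N e == snk N) = (uphalf e == l.+1)%N.
Proof. by rewrite hdE/= val_vtx. Qed.

Lemma tl_snkE (e : 'I_(ne N)) : (tl N e == snk N) = false.
Proof. by rewrite tlE/= val_vtx//; have := edge_ltn e; lia. Qed.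

(** The sink has no outgoing edge and a single incoming one, of transit time 0. *)
Lemma flow_valueE (f : 'I_(ne N) -> R -> R) :
  flow_value N f = \int[mu]_(x in `[0, T]) f (edge l.*2.+1) x.
Proof.
apply: eq_Rintegral => x _.
rewrite (eq_bigl _ _ hd_snkE) (eq_bigl _ _ tl_snkE).
by rewrite big_pred0_eq subr0 sum_edge_last transit_last subr0.
Qed.

Lemma inner_vertexP (v : 'I_(nv N)) : v != src N -> v != snk N ->
  exists2 m, (m <= l)%N & v = m.+1 :> nat.
Proof.
case: v => v hv; rewrite -!val_eqE/= !val_vtx// => v0 vt.
move: hv; rewrite [nv _]/= => hv; exists v.-1; last by rewrite /=; lia.
by lia.
Qed.

Section Flow.
Variable f : 'I_(ne N) -> R -> R.
Hypothesis flowf : is_dyn_flow N f.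

Lemma flow_bounds e x : 0 <= f e x <= cap N e x.
Proof.
have [_ [f0 [fu _]]] := flowf.
have [h|h] := pselect (0 <= x <= T - transit N e); first exact: fu.
by rewrite f0// lexx cap_ge0.
Qed.

Lemma flow_ge0 e x : 0 <= f e x.
Proof. by case/andP: (flow_bounds e x). Qed.

Lemma flow_neg e x : x < 0 -> f e x = 0.
Proof. by move=> x0; apply: flowf.2.1 => /andP[]; rewrite leNgt x0. Qed.

Lemma bounded_mfun_flow e : bounded_mfun (f e).
Proof.
split; first by case: flowf.
exists large_cap => x; rewrite ger0_norm ?flow_ge0//.
by apply: le_trans (cap_le e x); case/andP: (flow_bounds e x).
Qed.

Let inflow v z := \sum_(e | hd N e == v) f e (z - transit N e).
Let outflow v z := \sum_(e | tl N e == v) f e z.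

Let bounded_mfun_inflow v : bounded_mfun (inflow v).
Proof.
apply: bounded_mfun_sum => e _.
exact: bounded_mfun_shift (bounded_mfun_flow e).
Qed.

Let bounded_mfun_outflow v : bounded_mfun (outflow v).
Proof. by apply: bounded_mfun_sum => e _; exact: bounded_mfun_flow. Qed.

(** The difference of strong conservation at the times [k + 1] and [k]. *)
Lemma unit_conservation v k : v != src N -> v != snk N -> (k < 2 ^ l.+1)%N ->
  \int[mu]_(z in `[k%:R, k%:R + 1[) outflow v z =
  \int[mu]_(z in `[k%:R, k%:R + 1[) inflow v z.
Proof.
move=> vs vt kT; have hio := bounded_mfunB _ _ (bounded_mfun_inflow v) (bounded_mfun_outflow v).
have ex0 n : (n <= 2 ^ l.+1)%N ->
    \int[mu]_(z in `[0, n%:R[) (inflow v z - outflow v z) = 0.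
  move=> nT; rewrite Rintegral_itv_bndo_bndc; last exact: bounded_mfun_integrable.
  by apply: flowf.2.2.2 => //; rewrite ler0n/= ler_nat.
have := ex0 _ kT.
rewrite -natr1 (Rintegral_split _ _ k%:R)//; last by rewrite lerDl.
rewrite (ex0 _ (ltnW kT)) add0r RintegralB//; try exact: bounded_mfun_integrable.
by move=> /eqP; rewrite subr_eq0 => /eqP.
Qed.

(* All transit times are even, so flow leaving the source during [0, 1) can
   only be found at a vertex during intervals [k, k + 1) with k even. *)
Lemma flow_odd e k : odd k -> (k < 2 ^ l.+1)%N ->
  \int[mu]_(z in `[k%:R, k%:R + 1[) f e z = 0.
Proof.
move=> ok kT; move em : (uphalf e) => m.
(* Induction along the chain, with [k] general because slow edges shift it. For the edge out of s,
   an odd [k] is at least 1, where the capacity is 0. *)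
elim: m e em k ok kT => [|m IH] e em k ok kT.
  apply: Rintegral_eq0 => z; rewrite /= in_itv/= => /andP[kz _]; apply/eqP; rewrite eq_le flow_ge0 andbT.
  have [_] := andP (flow_bounds e z); rewrite /=.
  have -> : (e == 0 :> nat) by lia.
  suff -> : (z < 1) = false by [].
  by apply/negbTE; rewrite -leNgt; apply: le_trans kz; rewrite ler1n; case: (k) ok.
have mv : (m.+1 < l.+2)%N by rewrite -em; exact: edge_ltn.
have vE : vtx m.+1 = m.+1 :> nat by rewrite val_vtx// ltnW.
have vs : vtx m.+1 != src N by rewrite -val_eqE /= vE val_vtx.
have vt : vtx m.+1 != snk N by rewrite -val_eqE /= vE val_vtx//; lia.
have in0 : \int[mu]_(z in `[k%:R, k%:R + 1[) inflow (vtx m.+1) z = 0.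
  rewrite Rintegral_sum; last first.
    by move=> i _; exact: bounded_mfun_shift (bounded_mfun_flow i).
  apply: big1 => i; rewrite hdE vE => /eqP[im].
  rewrite transitE; set t := transit_nat i.
  (* For [k < t] the shifted interval lies before time 0; otherwise [k - t] is again odd. *)
  case: (ltnP k t) => kt.
    apply: Rintegral_eq0 => z; rewrite /= in_itv/= => /andP[_ zk]; apply: flow_neg.
    have : (k.+1%:R : R) <= t%:R by rewrite ler_nat.
    by rewrite -natr1; lra.
  have := IH i im (k - t)%N.
  rewrite oddB// odd_transit_nat addbF => /(_ ok (leq_ltn_trans (leq_subr _ _) kT)).
  rewrite -(Rintegral_shift _ _ _ (- t%:R)); last exact: bounded_mfun_flow.
  by rewrite natrB// addrAC.
apply/eqP; rewrite eq_le Rintegral_nonneg ?andbT; last first.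
  by move=> z _; exact: flow_ge0.
rewrite -[leRHS]in0 -unit_conservation//; apply: Rintegral_le => //.
  exact: bounded_mfun_flow.
move=> z _; rewrite /outflow (bigD1 e)/=; last by rewrite -/(tl N e) tlE vE em.
by rewrite lerDl sumr_ge0// => i _; exact: flow_ge0.
Qed.

Lemma flow_last_le k : (k < 2 ^ l.+1)%N ->
  \int[mu]_(z in `[k%:R, k%:R + 1[) f (edge l.*2.+1) z <= (~~ odd k)%:R.
Proof.
move=> kT; case: (boolP (odd k)) => ok; first by rewrite flow_odd.
rewrite -[leRHS](Rintegral_unit_cst 1 k%:R); apply: Rintegral_le.
- exact: bounded_mfun_flow.
- exact: bounded_mfun_cst.
- by move=> z _; rewrite -(cap_last z); case/andP: (flow_bounds (edge l.*2.+1) z).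
Qed.

(** The bounds of [flow_last_le] sum to exactly [2 ^ l], so a flow of this value makes each of them
    tight. *)
Lemma flow_last_eq k : (2 ^ l)%:R <= flow_value N f -> (k < 2 ^ l.+1)%N ->
  \int[mu]_(z in `[k%:R, k%:R + 1[) f (edge l.*2.+1) z = (~~ odd k)%:R.
Proof.
rewrite flow_valueE Rintegral_nat_split; last exact: bounded_mfun_flow.
rewrite -sum_even -mul2n -expnS -subr_ge0 -sumrB => ge0 kT.
apply/eqP; rewrite eq_le flow_last_le//=.
move: ge0; rewrite (bigD1 (Ordinal kT))//= => ge0.
rewrite -subr_ge0; apply: le_trans ge0 _; rewrite gerDl.
by apply: sumr_le0 => i _; rewrite subr_le0; exact: flow_last_le.
Qed.

End Flow.

(** * A flow of value [2 ^ l], and the complexity of every maximum flow *)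

(** Each v_i with i < l splits its flow evenly between two edges, so the rate halves at every stage.
    Truncated subtraction gives rate 1 on the last edge, and the truncated predecessor gives
    [pulse 0] on the first. *)
Definition pulse_flow (e : 'I_(ne N)) (x : R) : R :=
  (2 ^ (l - uphalf e))%:R * (pulse (uphalf e).-1 x)%:R.

(** Conservation holds even pointwise: parallel incoming edges deliver the two summands of [pulseS],
    and the halved rate is carried by twice as many outgoing edges, except at v_l, where it stays
    1. *)
Lemma pulse_flow_conservation m x : (m <= l)%N ->
  \sum_(e : 'I_(ne N) | uphalf e == m) pulse_flow e (x - transit N e) =
  \sum_(e : 'I_(ne N) | uphalf e == m.+1) pulse_flow e x.
Proof.
move=> ml.
have -> : \sum_(e : 'I_(ne N) | uphalf e == m.+1) pulse_flow e x =
    (2 ^ (l - m))%:R * (pulse m x)%:R.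
  have [->|ml'] := eqVneq m l.
    rewrite sum_edge_last /pulse_flow val_edge//.
    have -> : (uphalf l.*2.+1 = l.+1)%N by lia.
    by rewrite subnn; have -> : (l - l.+1 = 0)%N by lia.
  rewrite sum_edge_mid; last by lia.
  rewrite /pulse_flow !val_edge; [|lia..].
  have -> : (uphalf m.+1.*2.-1 = m.+1)%N by lia.
  have -> : (uphalf m.+1.*2 = m.+1)%N by lia.
  have -> : (l - m = (l - m.+1).+1)%N by lia.
  by rewrite -mulrDl -natrD addnn -mul2n -expnS.
have [m0|m0] := posnP m.
  rewrite m0 sum_edge0 transitE /pulse_flow val_edge//= subr0.
  by [].
rewrite sum_edge_mid; last by lia.
rewrite !transitE /pulse_flow !val_edge; [|lia..].
have -> : (uphalf m.*2.-1 = m)%N by lia.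
have -> : (uphalf m.*2 = m)%N by lia.
have -> : transit_nat m.*2.-1 = 0%N.
  by rewrite /transit_nat; have -> : odd m.*2.-1 by lia.
have -> : transit_nat m.*2 = (2 ^ m)%N.
  rewrite /transit_nat odd_double doubleK.
  by have -> : (m.*2 == 0)%N = false by lia.
by rewrite -mulrDr subr0 -[in RHS](prednK m0) pulseS (prednK m0).
Qed.

Lemma pulse_flow_is_flow : is_dyn_flow N pulse_flow.
Proof.
have hp e : bounded_mfun (pulse_flow e).
  apply: bounded_mfunM; first exact: bounded_mfun_cst.
  by apply: bounded_mfun_bool; exact: measurable_pulse.
split; [by move=> e; case: (hp e) | split; [|split]].
- move=> e x nx; rewrite /pulse_flow; case: (boolP (pulse _ x)); last by rewrite mulr0.
  move=> /pulse_bounds/andP[x0 x1]; exfalso; apply: nx; rewrite transitE x0 [horizon _]/=.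
  (* All flow must leave [e] by the horizon: for a slow edge the pulse length and the transit time
     are both bounded by the same power [2 ^ e./2], at most [2 ^ l]. *)
  suff : ((2 ^ (uphalf e).-1.+1 + transit_nat e)%N%:R : R) <= T by rewrite natrD; lra.
  rewrite ler_nat /transit_nat; have el := edge_ltn e.
  case: ifP => eo.
    by rewrite addn0 leq_exp2l//; lia.
  have half k : odd k || (k == 0)%N = false -> (k < l.*2.+2)%N ->
      ((uphalf k).-1.+1 = k./2)%N /\ (k./2 <= l)%N by lia.
  have [-> e2] := half _ eo (ltn_ord e).
  by rewrite addnn -mul2n -expnS leq_exp2l.
- move=> e x _; rewrite /pulse_flow mulr_ge0//=.
  have b1 := large_cap_ge1.
  have le2 : (2 ^ (l - uphalf e))%:R * (pulse (uphalf e).-1 x)%:R <= large_cap.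
    apply: (@le_trans _ _ ((2 ^ (l - uphalf e))%:R * 1)).
      by apply: ler_wpM2l => //; case: (pulse _ _).
    rewrite mulr1 /large_cap; apply: (@le_trans _ _ (2 ^ l)%:R); last by rewrite lerDl.
    by rewrite ler_nat leq_exp2l// leq_subr.
  case: ifP => [/eqP e0|_].
    case: ifP => // x1; rewrite e0 /= x1 andbF mulr0//.
  case: ifP => // /eqP ->.
  have -> : (l - uphalf l.*2.+1 = 0)%N by lia.
  by rewrite expn0 mul1r; case: (pulse _ _).
- move=> v vs vt Th _; have [m ml vm] := inner_vertexP v vs vt.
  apply: Rintegral_eq0 => x _.
  rewrite (eq_bigl (fun e : 'I_(ne N) => uphalf e == m)); last by move=> e; rewrite hdE vm.
  rewrite pulse_flow_conservation//.
  rewrite [X in _ - X](eq_bigl (fun e : 'I_(ne N) => uphalf e == m.+1)) ?subrr//.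
  by move=> e; rewrite tlE vm.
Qed.

Lemma pulse_flow_value : flow_value N pulse_flow = (2 ^ l)%:R.
Proof.
rewrite flow_valueE -(Rintegral_pulse l); apply: eq_Rintegral => x _.
rewrite /pulse_flow val_edge//; have -> : (uphalf l.*2.+1 = l.+1)%N by lia.
have -> : (l - l.+1 = 0)%N by lia.
by rewrite mul1r.
Qed.

(** Comparison with [pulse_flow] makes the unit integrals on the last edge tight, and the bounds 0
    and 1 then fix its rate almost everywhere. *)
Lemma max_flow_complexity f : is_max_dyn_flow N f -> flow_complexity_ge N f (2 ^ l).
Proof.
move=> [flowf maxf].
have val : (2 ^ l)%:R <= flow_value N f.
  by rewrite -pulse_flow_value; apply: maxf; exact: pulse_flow_is_flow.
set g := f (edge l.*2.+1).
have hg : bounded_mfun g by exact: bounded_mfun_flow.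
have g0 x : 0 <= g x by exact: flow_ge0.
have g1 x : g x <= 1.
  by rewrite -(cap_last x); case/andP: (flow_bounds f flowf (edge l.*2.+1) x).
have fib k : (k < 2 ^ l.+1)%N ->
    mu (`[k%:R, k%:R + 1[ `&` [set y | g y <> (~~ odd k)%:R]) = 0%E.
  move=> kT; have int_g := flow_last_eq f flowf k val kT.
  have setE c : [set x | g x - c != 0] = [set y | g y <> c].
    by apply/seteqP; split => y /=; rewrite subr_eq0 => /eqP.
  (* The nonnegative function with zero integral is [g] for odd [k] and [1 - g] for even [k]. *)
  case: (boolP (odd k)) int_g => ok /= int_g.
    rewrite -setE; apply: Rintegral_eq0_null.
    + by apply: bounded_mfunB => //; exact: bounded_mfun_cst.
    + by move=> x _; rewrite subr0.
    + by under eq_Rintegral do rewrite subr0.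
  have -> : [set y | g y <> 1] = [set y | 1 - g y != 0].
    by apply/seteqP; split => y /=; rewrite subr_eq0 eq_sym => /eqP.
  apply: Rintegral_eq0_null.
  + by apply: bounded_mfunB => //; exact: bounded_mfun_cst.
  + by move=> x _; rewrite subr_ge0.
  + rewrite RintegralB//; last exact: bounded_mfun_integrable.
      by rewrite int_g Rintegral_unit_cst subrr.
    exact: (bounded_mfun_integrable _ _ _ (bounded_mfun_cst 1)).
exists [seq (edge l.*2.+1, (j.*2.+1)%:R : R) | j <- iota 0 (2 ^ l)]; split; [|split].
- rewrite map_inj_uniq ?iota_uniq// => i j [] /eqP; rewrite eqr_nat => /eqP; lia.
- by rewrite size_map size_iota.
- move=> p /mapP[j]; rewrite mem_iota /= add0n => jl -> /=.
  have l2 : (2 ^ l.+1 = (2 ^ l).*2)%N by rewrite expnS mul2n.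
  split; first by rewrite -/(transit N _) transit_last subr0 ltr0n ltr_nat; lia.
  have e1 : (j.*2.+1)%:R - 1 = (j.*2)%:R :> R by rewrite -natr1 addrK.
  apply: (@not_locally_ae_const _ _ _ 1 0).
  + by move=> c; rewrite -[X in measurable X]setTI; exact: (hg.1 measurableT [set c]).
  + by apply/eqP; rewrite oner_eq0.
  + have := fib j.*2; rewrite odd_double /= natr1 e1; apply; lia.
  + have := fib j.*2.+1; rewrite /= odd_double /=; apply; lia.
Qed.

End Network.

Theorem theorem4 (R : realType) :
  exists c k : nat, forall l : nat, (0 < l)%N ->
    exists N : network R,
      (nv N + ne N <= c * l ^ k)%N /\
      valid_network N /\
      acyclic_network N /\
      (exists (e0 : 'I_(ne N)) (theta0 a b delta : R),
         one_capacity_change_at N e0 theta0 a b /\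
         0 < delta /\
         integer_multiple delta (horizon N) /\
         (forall e, integer_multiple delta (transit N e)) /\
         integer_multiple delta theta0) /\
      (forall S, is_min_dyn_cut N S -> cut_complexity_ge N S (2 ^ l)) /\
      (forall f, is_max_dyn_flow N f -> flow_complexity_ge N f (2 ^ l)).
Proof.
(* There are l + 3 vertices and 2l + 2 edges, and 3l + 5 is at most 8l for positive l. *)
exists 8%N, 1%N => l l0; exists (pulse_network R l).
split; first by rewrite /= expn1; lia.
split; first exact: pulse_network_valid.
split; first exact: pulse_network_acyclic.
split; first exact: pulse_network_one_change.
by split=> [S|f]; [exact: min_cut_complexity | exact: max_flow_complexity].
Qed.
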